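(* For $p\ge 2$ and $r\in(0,1)$, let $r'=\sqrt{1-r^2}$, $\pi_p=2\pi/(p\sin(\pi/p))$, and $$l_p(r)=\left(\frac{\pi_p}{2}\right)^2\left(\frac{p^2-(p-1)\log r^2}{p\,\pi_p-2\log r'^2}\right),\qquad u_p(r)=\left(\frac{p}{2}\right)^2\left(\frac{p\,\pi_p-2\log r^2}{p^2-(p-1)\log r'^2}\right).$$ (1) With $a=1/p$, the inequalities $l_p(r)<\mu_a(r)<u_p(r)$ hold. (2) For $p=2$, $u_2(r)<\frac{4}{\pi}\,l_2(r)$.
   Context: $F(a,b;c;z)=\sum_{n=0}^\infty \frac{(a,n)(b,n)}{(c,n)}\frac{z^n}{n!}$ for $|z|<1$ is the Gaussian hypergeometric function, where $(a,0)=1$ and $(a,n)=a(a+1)\cdots(a+n-1)$ for $n\ge 1$. For $a\in(0,1/2]$ and $r\in(0,1)$, $$\mu_a(r)=\frac{\pi}{2\sin(\pi a)}\frac{F(a,1-a;1;1-r^2)}{F(a,1-a;1;r^2)}.$$ Here $p$ is a real number. *)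

(* Defs.v *)
From Stdlib Require Import Reals Factorial.
From Coquelicot Require Import Coquelicot.
Open Scope R_scope.

(* The shifted factorial (a,n) = a (a+1) ... (a+n-1), with (a,0) = 1. *)
Fixpoint poch (a : R) (n : nat) : R :=
  match n with
  | O => 1
  | S m => poch a m * (a + INR m)
  end.

(* [PSeries] is total; its value is the sum of the series when |z| < 1
   and c is not a nonpositive integer, which covers every use below. *)
Definition hyp2F1 (a b c z : R) : R :=
  PSeries (fun n => poch a n * poch b n / (poch c n * INR (fact n))) z.

Definition mu (a r : R) : R :=
  PI / (2 * sin (PI * a)) *
  (hyp2F1 a (1 - a) 1 (1 - r ^ 2) / hyp2F1 a (1 - a) 1 (r ^ 2)).

Definition cmod (r : R) : R := sqrt (1 - r ^ 2).

Definition pi_p (p : R) : R := 2 * PI / (p * sin (PI / p)).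

Definition l_p (p r : R) : R :=
  (pi_p p / 2) ^ 2 *
  ((p ^ 2 - (p - 1) * ln (r ^ 2)) / (p * pi_p p - 2 * ln (cmod r ^ 2))).

Definition u_p (p r : R) : R :=
  (p / 2) ^ 2 *
  ((p * pi_p p - 2 * ln (r ^ 2)) / (p ^ 2 - (p - 1) * ln (cmod r ^ 2))).

(* Main.v *)
Require Import Defs.
From Stdlib Require Import Reals Factorial Lra Lia.
From Coquelicot Require Import Coquelicot.
Open Scope R_scope.

(** Put [a = 1/p], [s = sin (PI a)], [x = r^2] and [F x = F(a,1-a;1;x)].  After
    the constants are cleared, [mu_a r] is [PI/(2s) * F(1-x) / F(x)], and [l_p]
    and [u_p] have the same shape, with the values of [F] replaced by values of
    [1 - A ln(1-x)], where [A] is [a(1-a)] or [s/PI].  So part (1) is the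
    two-sided bound
    [[ 1 - a(1-a) ln(1-x) < F(x) < 1 - (s/PI) ln(1-x)   for 0 < x < 1, ]]
    used at [x] and at [1-x] ([hyp2F1_gt_log], [hyp2F1_lt_log]).

    Since [-ln(1-x)] is the sum of the [x^n/n], this bound holds coefficient by
    coefficient once the coefficients [c n] of [F] satisfy
    [a(1-a) <= n c n <= s/PI] for [n >= 1], each strict for some [n].  From
    [(n+1) c(n+1) / (n c n) = 1 + a(1-a)/(n(n+1))] the sequence [n c n] is
    strictly increasing from [a(1-a)], which is the left inequality.  Its limit
    is [s/PI] by the sine product, but the upper bound has a direct proof.
    The integrals [J b k] of [cos (b t) * (cos t)^k] over [0, PI/2] satisfy a
    two-term recurrence from [k] to [k+2], which yields the exact formula
    [c m * (a+m) * PI * J (2a) (2m) = s * J 0 (2m)] ([hyp_coef_wallis]).  The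
    concavity estimate [cos (b t) >= 1 - b (1 - cos t)] bounds [J (2a) (2m)]
    below by the multiple [(m+1-a)/(m+1)] of [J 0 (2m)], and this is exactly
    what [n c n <= s/PI] requires for [n = m+1].

    For part (2), with [X = - ln x] and [Y = - ln(1-x)], clearing denominators
    turns the claim into [X Y < 4 PI] (as [PI < 4]), while [ln y <= y - 1] gives
    [X Y <= 1]. *)

(** * Power series comparison with the logarithm *)

Lemma ex_pseries_bounded (a : nat -> R) (M x : R) :
  (forall n, Rabs (a n) <= M) -> Rabs x < 1 -> ex_pseries a x.
Proof.
intros Ha Hx.
apply (ex_series_le (fun n => scal (pow_n x n) (a n)) (fun n => M * Rabs x ^ n)).
- intro n.
  change (Rabs (pow_n x n * a n) <= M * Rabs x ^ n).
  rewrite Rabs_mult, pow_n_pow, <- RPow_abs, Rmult_comm.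
  apply Rmult_le_compat_r; [|apply Ha].
  apply pow_le, Rabs_pos.
- apply (ex_series_scal_l M (fun n => Rabs x ^ n)).
  apply ex_series_geom. rewrite Rabs_Rabsolu. exact Hx.
Qed.

Lemma CV_radius_bounded_ge_1 (a : nat -> R) (M : R) :
  (forall n, Rabs (a n) <= M) -> Rbar_le 1 (CV_radius a).
Proof.
intro Ha.
apply CV_radius_bounded.
exists M. intro n. rewrite pow1, Rmult_1_r. apply Ha.
Qed.

(** Strictness in one coefficient survives because the difference of the two
    sums is at least that single term. *)
Lemma PSeries_lt (a b : nat -> R) (k : nat) (x : R) :
  0 < x -> ex_pseries a x -> ex_pseries b x ->
  (forall n, a n <= b n) -> a k < b k -> PSeries a x < PSeries b x.
Proof.
intros Hx Ea Eb Hle Hlt.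
assert (Ea' : ex_series (fun n => a n * x ^ n)).
{ apply ex_series_ext with (2 := Ea). intro n.
  change (pow_n x n * a n = a n * x ^ n). rewrite pow_n_pow. ring. }
assert (Eb' : ex_series (fun n => b n * x ^ n)).
{ apply ex_series_ext with (2 := Eb). intro n.
  change (pow_n x n * b n = b n * x ^ n). rewrite pow_n_pow. ring. }
assert (Ed : ex_series (fun n => b n * x ^ n - a n * x ^ n)).
{ exact (ex_series_minus _ _ Eb' Ea'). }
assert (Hd : forall n, 0 <= b n * x ^ n - a n * x ^ n).
{ intro n. specialize (Hle n). assert (0 < x ^ n) by (apply pow_lt; lra). nra. }
assert (Hs : b k * x ^ k - a k * x ^ k
             <= Series (fun n => b n * x ^ n - a n * x ^ n)).
{ apply Rle_trans with (sum_n (fun n => b n * x ^ n - a n * x ^ n) k).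
  - destruct k as [|k].
    + rewrite sum_O. apply Rle_refl.
    + rewrite sum_Sn. change (plus ?u ?v) with (u + v).
      assert (0 <= sum_n (fun n => b n * x ^ n - a n * x ^ n) k).
      { rewrite sum_n_Reals. apply cond_pos_sum. exact Hd. }
      lra.
  - apply (is_lim_seq_incr_compare (sum_n (fun n => b n * x ^ n - a n * x ^ n))).
    + apply Series_correct, Ed.
    + intro n. rewrite sum_Sn. change (plus ?u ?v) with (u + v).
      specialize (Hd (S n)). lra. }
rewrite Series_minus in Hs by assumption.
unfold PSeries.
assert (0 < x ^ k) by (apply pow_lt; lra).
assert (0 < b k * x ^ k - a k * x ^ k) by nra.
lra.
Qed.

(** Taylor coefficients of [1 - A ln (1 - x)]. *)
Definition log_coef (A : R) (n : nat) : R :=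
  match n with O => 1 | S _ => A / INR n end.

Lemma log_coef_bounded (A : R) (n : nat) :
  Rabs (log_coef A n) <= Rmax 1 (Rabs A).
Proof.
destruct n as [|n].
- simpl. rewrite Rabs_R1. apply Rmax_l.
- unfold log_coef. apply Rle_trans with (Rabs A); [|apply Rmax_r].
  unfold Rdiv. rewrite Rabs_mult.
  assert (H : 1 <= INR (S n)) by (rewrite S_INR; pose proof (pos_INR n); lra).
  rewrite (Rabs_right (/ INR (S n))).
  2: { apply Rle_ge, Rlt_le, Rinv_0_lt_compat. lra. }
  rewrite <- (Rmult_1_r (Rabs A)) at 2.
  apply Rmult_le_compat_l; [apply Rabs_pos|].
  rewrite <- Rinv_1. apply Rinv_le_contravar; lra.
Qed.

(** Both sides have derivative [A / (1 - x)], the geometric series, and agree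
    at [0]. *)
Lemma PSeries_log_coef (A x : R) :
  0 < x < 1 -> PSeries (log_coef A) x = 1 - A * ln (1 - x).
Proof.
intro Hx.
set (h := fun t => PSeries (log_coef A) t + A * ln (1 - t)).
assert (Hd : forall t, 0 <= t <= x -> is_derive h t 0).
{ intros t Ht.
  assert (Hr : Rbar_lt (Rabs t) (CV_radius (log_coef A))).
  { apply Rbar_lt_le_trans with (y := 1).
    - simpl. rewrite Rabs_right; lra.
    - apply CV_radius_bounded_ge_1 with (1 := log_coef_bounded A). }
  pose proof (is_derive_PSeries _ _ Hr) as H1.
  assert (Hg : PSeries (PS_derive (log_coef A)) t = A / (1 - t)).
  { unfold PSeries.
    rewrite (Series_ext _ (fun n => A * t ^ n)).
    - rewrite Series_scal_l, Series_geom by (rewrite Rabs_right; lra).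
      reflexivity.
    - intro n. unfold PS_derive, log_coef. field.
      apply not_0_INR. lia. }
  rewrite Hg in H1.
  assert (H2 : is_derive (fun t => A * ln (1 - t)) t (- (A / (1 - t)))).
  { auto_derive; [lra|]. field. lra. }
  pose proof (is_derive_plus _ _ _ _ _ H1 H2) as H3.
  replace 0 with (plus (A / (1 - t)) (- (A / (1 - t)))).
  - exact H3.
  - exact (Rplus_opp_r _). }
destruct (MVT_gen h 0 x (fun _ => 0)) as [c [_ Hc]].
- rewrite Rmin_left, Rmax_right by lra. intros t Ht. apply Hd. lra.
- rewrite Rmin_left, Rmax_right by lra. intros t Ht.
  apply continuity_pt_filterlim, (ex_derive_continuous h).
  exists 0. apply Hd. lra.
- unfold h in Hc. rewrite PSeries_0 in Hc.
  rewrite Rminus_0_r, ln_1 in Hc. simpl in Hc. lra.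
Qed.

(** * Coefficients of the hypergeometric series *)

Definition hyp_coef (a : R) (n : nat) : R :=
  poch a n * poch (1 - a) n / (poch 1 n * INR (fact n)).

Lemma hyp2F1_hyp_coef (a x : R) : hyp2F1 a (1 - a) 1 x = PSeries (hyp_coef a) x.
Proof. reflexivity. Qed.

Lemma hyp_coef_0 (a : R) : hyp_coef a 0 = 1.
Proof. unfold hyp_coef; simpl; field. Qed.

Lemma poch_1_gt0 (n : nat) : 0 < poch 1 n.
Proof.
induction n as [|n IH]; simpl; [lra|].
pose proof (pos_INR n). nra.
Qed.

Lemma hyp_coef_S (a : R) (n : nat) :
  hyp_coef a (S n)
  = hyp_coef a n * ((a + INR n) * (1 - a + INR n)) / (INR n + 1) ^ 2.
Proof.
unfold hyp_coef. rewrite fact_simpl, mult_INR, S_INR. cbn [poch].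
pose proof (pos_INR n). pose proof (poch_1_gt0 n). pose proof (INR_fact_lt_0 n).
field. repeat split; lra.
Qed.

Lemma hyp_coef_gt0 (a : R) (n : nat) : 0 < a < 1 -> 0 < hyp_coef a n.
Proof.
intro Ha. induction n as [|n IH]; [rewrite hyp_coef_0; lra|].
rewrite hyp_coef_S. pose proof (pos_INR n).
apply Rdiv_lt_0_compat; [|nra].
apply Rmult_lt_0_compat; [exact IH|nra].
Qed.

Lemma hyp_coef_bounded (a : R) (n : nat) : 0 < a < 1 -> Rabs (hyp_coef a n) <= 1.
Proof.
intro Ha. rewrite Rabs_right by (apply Rle_ge, Rlt_le, hyp_coef_gt0, Ha).
induction n as [|n IH]; [rewrite hyp_coef_0; lra|].
rewrite hyp_coef_S. pose proof (pos_INR n). pose proof (hyp_coef_gt0 a n Ha).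
apply Rle_trans with (2 := IH).
assert (0 < (INR n + 1) ^ 2) by nra.
apply Rmult_le_reg_r with ((INR n + 1) ^ 2); [assumption|].
unfold Rdiv. rewrite Rmult_assoc, Rinv_l, Rmult_1_r by lra.
apply Rmult_le_compat_l; nra.
Qed.

Lemma hyp_coef_SS (a : R) (n : nat) :
  INR (S (S n)) * hyp_coef a (S (S n))
  = INR (S n) * hyp_coef a (S n)
    * (1 + a * (1 - a) / (INR (S n) * INR (S (S n)))).
Proof.
rewrite (hyp_coef_S a (S n)), !S_INR. pose proof (pos_INR n).
field. split; lra.
Qed.

Lemma hyp_coef_lt_step (a : R) (n : nat) : 0 < a < 1 ->
  INR (S n) * hyp_coef a (S n) < INR (S (S n)) * hyp_coef a (S (S n)).
Proof.
intro Ha. rewrite hyp_coef_SS.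
assert (Hp : forall m, 0 < INR (S m)) by (intro m; apply lt_0_INR; lia).
assert (0 < a * (1 - a) / (INR (S n) * INR (S (S n)))).
{ apply Rdiv_lt_0_compat; [nra|]. apply Rmult_lt_0_compat; apply Hp. }
assert (0 < INR (S n) * hyp_coef a (S n)).
{ apply Rmult_lt_0_compat; [apply Hp|apply hyp_coef_gt0, Ha]. }
nra.
Qed.

Lemma hyp_coef_lower (a : R) (n : nat) : 0 < a < 1 ->
  a * (1 - a) <= INR (S n) * hyp_coef a (S n).
Proof.
intro Ha. induction n as [|n IH].
- rewrite hyp_coef_S, hyp_coef_0. simpl. lra.
- pose proof (hyp_coef_lt_step a n Ha). lra.
Qed.

(** * Wallis-type integrals *)

(** At [b = 0] these are Wallis's integrals; for other [b] the base case
    [sin (PI b / 2) / b] is what brings [sin (PI a)] into the coefficient bound. *)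
Definition wallis (b : R) (k : nat) : R :=
  RInt (fun t => cos (b * t) * cos t ^ k) 0 (PI / 2).

Lemma wallis_integrand_continuous (b : R) (k : nat) (t : R) :
  continuous (fun t => cos (b * t) * cos t ^ k) t.
Proof.
apply (ex_derive_continuous (fun t => cos (b * t) * cos t ^ k)).
auto_derive. exact I.
Qed.

Lemma is_RInt_wallis (b : R) (k : nat) :
  is_RInt (fun t => cos (b * t) * cos t ^ k) 0 (PI / 2) (wallis b k).
Proof.
apply (RInt_correct (V := R_CompleteNormedModule)).
apply (ex_RInt_continuous (fun t => cos (b * t) * cos t ^ k)).
intros t _. apply wallis_integrand_continuous.
Qed.

Lemma wallis_gt0 (b : R) (k : nat) : 0 <= b <= 1 -> 0 < wallis b k.
Proof.
intro Hb. pose proof PI_RGT_0.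
apply RInt_gt_0; [lra| |].
- intros t Ht. apply Rmult_lt_0_compat.
  + apply cos_gt_0; nra.
  + apply pow_lt, cos_gt_0; lra.
- intros t _. apply wallis_integrand_continuous.
Qed.

Lemma wallis_0_0 : wallis 0 0 = PI / 2.
Proof.
unfold wallis. rewrite (RInt_ext _ (fun _ => 1)).
- rewrite RInt_const. change (scal ?u ?v) with (u * v). lra.
- intros t _. rewrite Rmult_0_l, cos_0. simpl. ring.
Qed.

Lemma wallis_b_0 (b : R) : b <> 0 -> wallis b 0 = sin (b * (PI / 2)) / b.
Proof.
intro Hb. unfold wallis. apply is_RInt_unique.
replace (sin (b * (PI / 2)) / b)
  with (minus (sin (b * (PI / 2)) / b) (sin (b * 0) / b)).
- apply (is_RInt_derive (fun t => sin (b * t) / b)).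
  + intros t _. auto_derive; [exact I|]. simpl. field. exact Hb.
  + intros t _. apply (wallis_integrand_continuous b 0).
- change (sin (b * (PI / 2)) / b - sin (b * 0) / b = sin (b * (PI / 2)) / b).
  rewrite Rmult_0_r, sin_0. field. exact Hb.
Qed.

(** Two integrations by parts carried out at once: this primitive vanishes at
    both ends of [0, PI/2], so integrating its derivative relates the integrals
    with exponents [k] and [k+2]. *)
Lemma is_derive_wallis_primitive (b : R) (k : nat) (t : R) :
  is_derive
    (fun t => b * sin (b * t) * cos t ^ S (S k)
              - (INR k + 2) * cos (b * t) * cos t ^ S k * sin t) t
    ((INR k + 2) * (INR k + 1) * (cos (b * t) * cos t ^ k)
     - ((INR k + 2) ^ 2 - b ^ 2) * (cos (b * t) * cos t ^ S (S k))).
Proof.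
auto_derive; [exact I|].
cbn [Init.Nat.pred].
change (match k with O => 1 | S _ => INR k + 1 end) with (INR (S k)).
rewrite ?S_INR. cbn [pow].
pose proof (sin2_cos2 t) as Hs. unfold Rsqr in Hs.
assert (Hs' : sin t * sin t = 1 - cos t * cos t) by lra.
ring [Hs'].
Qed.

Lemma wallis_rec (b : R) (k : nat) :
  ((INR k + 2) ^ 2 - b ^ 2) * wallis b (S (S k))
  = (INR k + 2) * (INR k + 1) * wallis b k.
Proof.
pose (G := fun t => b * sin (b * t) * cos t ^ S (S k)
                    - (INR k + 2) * cos (b * t) * cos t ^ S k * sin t).
pose (g := fun t => (INR k + 2) * (INR k + 1) * (cos (b * t) * cos t ^ k)
  - ((INR k + 2) ^ 2 - b ^ 2) * (cos (b * t) * cos t ^ S (S k))).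
assert (H1 : is_RInt g 0 (PI / 2)
  ((INR k + 2) * (INR k + 1) * wallis b k
   - ((INR k + 2) ^ 2 - b ^ 2) * wallis b (S (S k)))).
{ apply (is_RInt_minus (V := R_NormedModule));
    apply (is_RInt_scal (V := R_NormedModule)); apply is_RInt_wallis. }
assert (H2 : is_RInt g 0 (PI / 2) (G (PI / 2) - G 0)).
{ apply (is_RInt_derive G g).
  - intros t _. apply is_derive_wallis_primitive.
  - intros t _. apply (ex_derive_continuous g). unfold g.
    auto_derive. exact I. }
assert (H : (INR k + 2) * (INR k + 1) * wallis b k
            - ((INR k + 2) ^ 2 - b ^ 2) * wallis b (S (S k)) = G (PI / 2) - G 0).
{ rewrite <- (is_RInt_unique _ _ _ _ H1). exact (is_RInt_unique _ _ _ _ H2). }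
unfold G in H. rewrite Rmult_0_r, sin_0, cos_PI2 in H. simpl in H. lra.
Qed.

(** The chord of the cosine: the difference vanishes at [t = 0] and its
    derivative [b (sin t - sin (b t))] is nonnegative. *)
Lemma cos_scaled_ge (b t : R) :
  0 <= b <= 1 -> 0 <= t <= PI / 2 -> 1 - b * (1 - cos t) <= cos (b * t).
Proof.
intros Hb Ht.
set (g := fun u => cos (b * u) - (1 - b * (1 - cos u))).
set (g' := fun u => b * (sin u - sin (b * u))).
assert (Hd : forall u, is_derive g u (g' u)).
{ intro u. unfold g, g'. auto_derive; [exact I|]. ring. }
destruct (MVT_gen g 0 t g') as [c [Hc E]].
- intros u _. apply Hd.
- intros u _. apply continuity_pt_filterlim, (ex_derive_continuous g).
  exists (g' u). apply Hd.
- rewrite Rmin_left, Rmax_right in Hc by lra.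
  assert (H0 : g 0 = 0) by (unfold g; rewrite Rmult_0_r, cos_0; ring).
  assert (Hg' : 0 <= g' c).
  { unfold g'. apply Rmult_le_pos; [lra|].
    assert (sin (b * c) <= sin c) by (apply sin_incr_1; nra).
    lra. }
  assert (0 <= g t) by nra.
  unfold g in *. lra.
Qed.

(** Integrate [cos (b t) >= 1 - b (1 - cos t) >= (1-b) + b (cos t)^2] against
    the weight [(cos t)^k]; then [wallis_rec] at [b = 0] rewrites the [k+2]
    integral. *)
Lemma wallis_lower (b : R) (k : nat) : 0 <= b <= 1 ->
  wallis 0 k * (INR k + 2 - b) <= (INR k + 2) * wallis b k.
Proof.
intro Hb. pose proof PI_RGT_0. pose proof (pos_INR k).
assert (H1 : (1 - b) * wallis 0 k + b * wallis 0 (S (S k)) <= wallis b k).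
{ apply (is_RInt_le
    (fun t => (1 - b) * (cos (0 * t) * cos t ^ k)
              + b * (cos (0 * t) * cos t ^ S (S k)))
    (fun t => cos (b * t) * cos t ^ k) 0 (PI / 2)).
  - lra.
  - apply (is_RInt_plus (V := R_NormedModule));
      apply (is_RInt_scal (V := R_NormedModule)); apply is_RInt_wallis.
  - apply is_RInt_wallis.
  - intros t Ht. rewrite Rmult_0_l, cos_0. cbn [pow].
    assert (Hc : 0 <= cos t <= 1).
    { split; [apply cos_ge_0; lra|apply COS_bound]. }
    pose proof (pow_le (cos t) k (proj1 Hc)).
    assert (1 - b * (1 - cos t) <= cos (b * t)) by (apply cos_scaled_ge; lra).
    assert (0 <= b * (cos t * (1 - cos t))).
    { repeat apply Rmult_le_pos; lra. }
    assert (1 - b + b * (cos t * cos t) <= cos (b * t)) by lra.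
    assert ((1 - b + b * (cos t * cos t)) * cos t ^ k <= cos (b * t) * cos t ^ k)
      by (apply Rmult_le_compat_r; assumption).
    lra. }
pose proof (wallis_rec 0 k) as H2.
assert (H3 : (INR k + 2) * wallis 0 (S (S k)) = (INR k + 1) * wallis 0 k).
{ apply Rmult_eq_reg_l with (INR k + 2); lra. }
assert (H4 : (INR k + 2) * ((1 - b) * wallis 0 k + b * wallis 0 (S (S k)))
             <= (INR k + 2) * wallis b k) by (apply Rmult_le_compat_l; lra).
nra.
Qed.

(** * The sharp bounds for F(a,1-a;1;x) *)

(** A finite form of the sine product: both [wallis] factors obey
    [wallis_rec], and the quotient of the two recurrences is the recurrence of
    the coefficients. *)
Lemma hyp_coef_wallis (a : R) (m : nat) : 0 < a < 1 ->
  hyp_coef a m * (a + INR m) * PI * wallis (2 * a) (2 * m)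
  = sin (PI * a) * wallis 0 (2 * m).
Proof.
intro Ha. induction m as [|m IH].
- change (2 * 0)%nat with 0%nat.
  rewrite hyp_coef_0, wallis_b_0, wallis_0_0 by lra.
  replace (2 * a * (PI / 2)) with (PI * a) by field.
  simpl. field. lra.
- replace (2 * S m)%nat with (S (S (2 * m))) by lia.
  pose proof (wallis_rec (2 * a) (2 * m)) as H1.
  pose proof (wallis_rec 0 (2 * m)) as H2.
  rewrite mult_INR in H1, H2. change (INR 2) with (1 + 1) in H1, H2.
  pose proof (pos_INR m) as Hm. set (x := INR m) in *.
  assert (E1 : wallis (2 * a) (S (S (2 * m)))
    = (x + 1) * (2 * x + 1) / (2 * (x + 1 - a) * (x + 1 + a))
      * wallis (2 * a) (2 * m)).
  { apply Rmult_eq_reg_l with (((1 + 1) * x + 2) ^ 2 - (2 * a) ^ 2);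
      [|apply Rgt_not_eq; nra].
    rewrite H1. field. split; lra. }
  assert (E2 : wallis 0 (S (S (2 * m)))
    = (2 * x + 1) / (2 * (x + 1)) * wallis 0 (2 * m)).
  { apply Rmult_eq_reg_l with (((1 + 1) * x + 2) ^ 2 - 0 ^ 2); [|apply Rgt_not_eq; nra].
    rewrite H2. field. lra. }
  rewrite E1, E2, hyp_coef_S, S_INR. fold x.
  transitivity ((2 * x + 1) / (2 * (x + 1))
    * (hyp_coef a m * (a + x) * PI * wallis (2 * a) (2 * m))).
  + field. repeat split; lra.
  + rewrite IH. ring.
Qed.

Lemma hyp_coef_upper (a : R) (n : nat) : 0 < a <= 1 / 2 ->
  INR (S n) * hyp_coef a (S n) <= sin (PI * a) / PI.
Proof.
intro Ha. pose proof PI_RGT_0 as HPI. pose proof (pos_INR n) as Hn.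
assert (Ha1 : 0 < a < 1) by lra.
pose proof (hyp_coef_wallis a n Ha1) as Hw.
assert (Hlow : wallis 0 (2 * n) * (INR n + 1 - a)
               <= (INR n + 1) * wallis (2 * a) (2 * n)).
{ pose proof (wallis_lower (2 * a) (2 * n) ltac:(lra)) as H.
  rewrite mult_INR in H. change (INR 2) with (1 + 1) in H. nra. }
assert (Hpos : 0 < wallis (2 * a) (2 * n)) by (apply wallis_gt0; lra).
assert (Hs : 0 < sin (PI * a)) by (apply sin_gt_0; nra).
rewrite hyp_coef_S, S_INR.
apply Rmult_le_reg_r with (PI * (INR n + 1) * wallis (2 * a) (2 * n)).
{ apply Rmult_lt_0_compat; [apply Rmult_lt_0_compat|]; lra. }
transitivity ((hyp_coef a n * (a + INR n) * PI * wallis (2 * a) (2 * n))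
              * (INR n + 1 - a)).
{ right. field. lra. }
rewrite Hw.
transitivity (sin (PI * a) * ((INR n + 1) * wallis (2 * a) (2 * n))).
{ rewrite Rmult_assoc. apply Rmult_le_compat_l; lra. }
right. field. lra.
Qed.

Lemma hyp2F1_gt_log (a x : R) : 0 < a < 1 -> 0 < x < 1 ->
  1 - a * (1 - a) * ln (1 - x) < hyp2F1 a (1 - a) 1 x.
Proof.
intros Ha Hx.
rewrite <- PSeries_log_coef, hyp2F1_hyp_coef by exact Hx.
assert (Rabs x < 1) by (rewrite Rabs_right; lra).
(* The coefficients of [x] agree, so strictness first shows in that of [x^2]. *)
apply PSeries_lt with (k := 2%nat); [lra| | | |].
- apply ex_pseries_bounded with (1 := log_coef_bounded _). assumption.
- apply ex_pseries_bounded with (M := 1); [|assumption].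
  intro n. apply hyp_coef_bounded, Ha.
- intros [|n]; [rewrite hyp_coef_0; apply Rle_refl|].
  unfold log_coef. apply Rle_div_l; [apply lt_0_INR; lia|].
  rewrite (Rmult_comm (hyp_coef a (S n))). apply hyp_coef_lower, Ha.
- unfold log_coef. apply Rlt_div_l; [apply lt_0_INR; lia|].
  pose proof (hyp_coef_lower a 0 Ha). pose proof (hyp_coef_lt_step a 0 Ha).
  rewrite (Rmult_comm (hyp_coef _ _)). lra.
Qed.

Lemma hyp2F1_lt_log (a x : R) : 0 < a <= 1 / 2 -> 0 < x < 1 ->
  hyp2F1 a (1 - a) 1 x < 1 - sin (PI * a) / PI * ln (1 - x).
Proof.
intros Ha Hx. assert (Ha1 : 0 < a < 1) by lra.
rewrite <- PSeries_log_coef, hyp2F1_hyp_coef by exact Hx.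
assert (Rabs x < 1) by (rewrite Rabs_right; lra).
apply PSeries_lt with (k := 1%nat); [lra| | | |].
- apply ex_pseries_bounded with (M := 1); [|assumption].
  intro n. apply hyp_coef_bounded, Ha1.
- apply ex_pseries_bounded with (1 := log_coef_bounded _). assumption.
- intros [|n]; [rewrite hyp_coef_0; apply Rle_refl|].
  unfold log_coef. apply -> Rle_div_r; [|apply lt_0_INR; lia].
  rewrite (Rmult_comm (hyp_coef a (S n))). apply hyp_coef_upper, Ha.
- unfold log_coef. apply -> Rlt_div_r; [|apply lt_0_INR; lia].
  pose proof (hyp_coef_upper a 1 Ha). pose proof (hyp_coef_lt_step a 0 Ha1).
  rewrite (Rmult_comm (hyp_coef _ _)). lra.
Qed.

(** * Bounds for the modulus *)

Lemma ln_lt_0 (x : R) : 0 < x < 1 -> ln x < 0.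
Proof. intro Hx. rewrite <- ln_1. apply ln_increasing; lra. Qed.

Lemma ln_le_sub1 (x : R) : 0 < x -> ln x <= x - 1.
Proof.
intro Hx. rewrite <- (ln_exp (x - 1)).
apply ln_le; [exact Hx|]. pose proof (exp_ineq1_le (x - 1)). lra.
Qed.

(** Apply [ln y <= y - 1] at [y = 1/x] and [y = 1/(1-x)]: the two bounds are
    reciprocal to each other. *)
Lemma ln_mul_ln_compl_le_1 (x : R) : 0 < x < 1 -> ln x * ln (1 - x) <= 1.
Proof.
intro Hx.
assert (H : forall y, 0 < y < 1 -> 0 <= - ln y <= (1 - y) / y).
{ intros y Hy. pose proof (ln_lt_0 y Hy).
  pose proof (ln_le_sub1 (/ y) (Rinv_0_lt_compat y (proj1 Hy))) as H1.
  rewrite ln_Rinv in H1 by lra.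
  split; [lra|]. replace ((1 - y) / y) with (/ y - 1) by (field; lra). exact H1. }
pose proof (H x Hx) as H1. pose proof (H (1 - x) ltac:(lra)) as H2.
replace (ln x * ln (1 - x)) with (- ln x * - ln (1 - x)) by ring.
transitivity ((1 - x) / x * ((1 - (1 - x)) / (1 - x))).
- apply Rmult_le_compat; lra.
- right. field. lra.
Qed.

Lemma cmod_sq (r : R) : 0 < r < 1 -> cmod r ^ 2 = 1 - r ^ 2.
Proof. intro Hr. unfold cmod. apply pow2_sqrt. nra. Qed.

Lemma sin_PI_div_gt0 (p : R) : 2 <= p -> 0 < sin (PI / p).
Proof.
intro Hp. pose proof PI_RGT_0 as HPI. apply sin_gt_0.
- apply Rdiv_lt_0_compat; lra.
- apply Rlt_div_l; nra.
Qed.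

(** In this form [l_p] differs from [mu (1/p)] only in having logarithmic bounds
    in place of the two hypergeometric values; likewise for [u_p] below. *)
Lemma l_p_normal (p r : R) : 2 <= p -> 0 < r < 1 ->
  l_p p r = PI / (2 * sin (PI / p))
            * ((1 - 1 / p * (1 - 1 / p) * ln (r ^ 2))
               / (1 - sin (PI / p) / PI * ln (1 - r ^ 2))).
Proof.
intros Hp Hr. unfold l_p, pi_p. rewrite cmod_sq by exact Hr.
pose proof PI_RGT_0 as HPI. pose proof (sin_PI_div_gt0 p Hp) as Hs.
assert (HY : ln (1 - r ^ 2) < 0) by (apply ln_lt_0; nra).
set (s := sin (PI / p)) in *. set (Y := ln (1 - r ^ 2)) in *.
assert (0 < s * - Y) by (apply Rmult_lt_0_compat; lra).
field. repeat split; nra.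
Qed.

Lemma u_p_normal (p r : R) : 2 <= p -> 0 < r < 1 ->
  u_p p r = PI / (2 * sin (PI / p))
            * ((1 - sin (PI / p) / PI * ln (r ^ 2))
               / (1 - 1 / p * (1 - 1 / p) * ln (1 - r ^ 2))).
Proof.
intros Hp Hr. unfold u_p, pi_p. rewrite cmod_sq by exact Hr.
pose proof PI_RGT_0 as HPI. pose proof (sin_PI_div_gt0 p Hp) as Hs.
assert (HY : ln (1 - r ^ 2) < 0) by (apply ln_lt_0; nra).
set (s := sin (PI / p)) in *. set (Y := ln (1 - r ^ 2)) in *.
assert (0 < (p - 1) * - Y) by (apply Rmult_lt_0_compat; lra).
field. repeat split; nra.
Qed.

Lemma Rdiv_lt_compat (a b c d : R) :
  0 < a -> 0 < d -> a < b -> d < c -> a / c < b / d.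
Proof.
intros Ha Hd Hab Hdc. unfold Rdiv.
apply Rmult_gt_0_lt_compat; try lra.
- apply Rinv_0_lt_compat. lra.
- apply Rinv_lt_contravar; [nra|lra].
Qed.

Theorem theorem1p9 :
  (forall p r : R, 2 <= p -> 0 < r < 1 ->
     l_p p r < mu (1 / p) r /\ mu (1 / p) r < u_p p r) /\
  (forall r : R, 0 < r < 1 -> u_p 2 r < 4 / PI * l_p 2 r).
Proof.
pose proof PI_RGT_0 as HPI.
split.
- intros p r Hp Hr.
  rewrite l_p_normal, u_p_normal by assumption.
  assert (Hx : 0 < r ^ 2 < 1) by nra.
  assert (Hx' : 0 < 1 - r ^ 2 < 1) by lra.
  assert (Ha : 0 < 1 / p <= 1 / 2).
  { split; [apply Rdiv_lt_0_compat; lra|].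
    apply Rmult_le_compat_l; [lra|]. apply Rinv_le_contravar; lra. }
  assert (Ha1 : 0 < 1 / p < 1) by lra.
  pose proof (hyp2F1_gt_log _ _ Ha1 Hx) as L1.
  pose proof (hyp2F1_gt_log _ _ Ha1 Hx') as L2.
  pose proof (hyp2F1_lt_log _ _ Ha Hx) as U1.
  pose proof (hyp2F1_lt_log _ _ Ha Hx') as U2.
  replace (1 - (1 - r ^ 2)) with (r ^ 2) in L2, U2 by ring.
  unfold mu.
  replace (PI * (1 / p)) with (PI / p) in * by (field; lra).
  pose proof (sin_PI_div_gt0 p Hp) as Hs.
  pose proof (ln_lt_0 _ Hx) as HlX. pose proof (ln_lt_0 _ Hx') as HlY.
  assert (0 < 1 / p * (1 - 1 / p)) by nra.
  assert (0 < PI / (2 * sin (PI / p))) by (apply Rdiv_lt_0_compat; lra).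
  split; (apply Rmult_lt_compat_l; [assumption|]);
    apply Rdiv_lt_compat; nra.
- intros r Hr.
  rewrite l_p_normal, u_p_normal by (assumption || lra).
  assert (Hx : 0 < r ^ 2 < 1) by nra.
  pose proof (ln_mul_ln_compl_le_1 _ Hx) as Hprod.
  pose proof (ln_lt_0 _ Hx) as HlX.
  assert (HlY : ln (1 - r ^ 2) < 0) by (apply ln_lt_0; lra).
  rewrite sin_PI2, Rmult_1_r.
  set (X := ln (r ^ 2)) in *. set (Y := ln (1 - r ^ 2)) in *.
  assert (HPI3 : 3 < PI) by (pose proof PI2_3_2; lra).
  assert (HPI4 : PI < 4).
  { (* The coefficient bounds at [a = 1/2] contain [1/4 < 1/PI]. *)
    pose proof (hyp_coef_lower (1 / 2) 0 ltac:(lra)).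
    pose proof (hyp_coef_lt_step (1 / 2) 0 ltac:(lra)).
    pose proof (hyp_coef_upper (1 / 2) 1 ltac:(lra)) as Hup.
    replace (PI * (1 / 2)) with (PI / 2) in Hup by field.
    rewrite sin_PI2 in Hup.
    assert (H4 : 1 / 4 < 1 / PI) by lra.
    apply Rlt_div_r in H4; lra. }
  assert (HXY : 0 < 1 - 1 / 4 * Y) by lra.
  assert (HXP : 0 < 1 - 1 / PI * Y).
  { assert (0 < 1 / PI) by (apply Rdiv_lt_0_compat; lra). nra. }
  apply Rminus_lt_0.
  replace (4 / PI * (PI / 2 * ((1 - 1 / 2 * (1 - 1 / 2) * X) / (1 - 1 / PI * Y)))
           - PI / 2 * ((1 - 1 / PI * X) / (1 - 1 / 2 * (1 - 1 / 2) * Y)))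
    with ((4 - PI) * (4 * PI - X * Y)
          / (8 * PI * (1 - 1 / PI * Y) * (1 - 1 / 4 * Y))).
  2: { field. repeat split; nra. }
  apply Rdiv_lt_0_compat; [apply Rmult_lt_0_compat; lra|].
  apply Rmult_lt_0_compat; [apply Rmult_lt_0_compat|]; lra.
Qed.
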